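(* Let $\xi,\Delta:\{t_0,t_0+1,\dots\}\to\mathbb R^+$ be such that $\Delta$ and $t\mapsto\xi_t\Delta_t$ are non-increasing and $\xi$ is non-decreasing, and let $k:\{t_0,t_0+1,\dots\}\to\mathbb R$ be a query budget. Let $\alpha>0$, $T\in\mathbb R$, let $D=\{D_t\}_{t\ge t_0}$ be a database stream and $F=\{\{f_{t,i}\}_{i=1}^{\ell_t}\}_{t_0\le t\le t'}$ a finite query stream with sensitivity $\Delta_{f_{t,i}}\le\Delta_t$ for all $(t,i)$ satisfying $\sum_{\tau=t_0}^t\ell_\tau\le\sum_{\tau=t_0}^tk_\tau$ for all $t\ge t_0$. Let $h_t=|\{i:f_{t,i}(D_t)\ge T-\alpha\}|$. If $$\beta\ge\exp\!\Big(-\frac{\alpha\xi_{t_0}}{8}\Big)+\sum_{t=t_0}^\infty(\ell_t+2h_t)\exp\!\Big(-\frac{\alpha\xi_t}{8}\Big),$$ then with probability at least $1-\beta$, every answer $a_{t,i}=\bot$ of $\mathrm{NSG}(D,F,T,\xi)$ satisfies $f_{t,i}(D_t)\le T+\alpha$, and every numeric answer $a_{t,i}\in\mathbb R$ satisfies $f_{t,i}(D_t)\ge T-\alpha$ and $|f_{t,i}(D_t)-a_{t,i}|\le\alpha$. In particular the same conclusion holds whenever $$\beta\ge\exp\!\Big(-\frac{\alpha\xi_{t_0}}{8}\Big)+3\sum_{t=t_0}^\infty k_t\exp\!\Big(-\frac{\alpha\xi_t}{8}\Big).$$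
   Context: A database stream $D=\{D_t\}_{t\ge t_0}$ consists of databases $D_t$ of size $t$ over a finite universe, with $D_{t+1}$ obtained from $D_t$ by adding one entry. Query $f_{t,i}$ is a real-valued function on databases, arriving when the database has size $t$; its sensitivity $\Delta_{f_{t,i}}$ is $\max|f_{t,i}(E)-f_{t,i}(E')|$ over databases $E,E'$ of size $t$ differing in one entry. Here $\ell_t=0$ and $h_t=0$ for $t>t'$. $\mathrm{Lap}(b)$ has density $\frac1{2b}e^{-|z|/b}$. NATG (threshold $T$, noise function $\xi$): when started it draws $\eta\sim\mathrm{Lap}(2)$; on each subsequent query $f_{t,i}$ it draws fresh $\nu_{t,i}\sim\mathrm{Lap}(4/\xi_t)$; if $f_{t,i}(D_t)+\nu_{t,i}\ge T+\eta/\xi_t$ it outputs $f_{t,i}(D_t)+Z$, $Z\sim\mathrm{Lap}(8/\xi_t)$ fresh, and halts; otherwise outputs $\bot$. $\mathrm{NSG}(D,F,T,\xi)$: processes the queries in order; whenever a query arrives and no NATG instance is running, it starts a new NATG instance (fresh randomness) with the same $T,\xi$; it outputs the running instance's answer $a_{t,i}\in\mathbb R\cup\{\bot\}$ to each query. *)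

(* Defs.v *)
From HB Require Import structures.
From mathcomp Require Export all_boot all_order all_algebra.
From mathcomp Require Export all_classical all_reals all_analysis.

Set Implicit Arguments.
Unset Strict Implicit.
Unset Printing Implicit Defensive.

Import Order.TTheory GRing.Theory Num.Theory.
Import numFieldNormedType.Exports.

Local Open Scope classical_set_scope.
Local Open Scope ring_scope.

(* A database of size t over the finite universe U is a sequence of t entries;
   a query is a real-valued function on databases of any size. *)

Definition database_stream (U : finType) (t0 : nat) (D : nat -> seq U) : Prop :=
  forall t, (t0 <= t)%N ->
    size (D t) = t /\ exists x : U, D t.+1 = rcons (D t) x.

Definition differ_in_one (U : finType) (t : nat) (E E' : t.-tuple U) : bool :=
  #|[set i : 'I_t | tnth E i != tnth E' i]%SET| == 1%N.

(* The index set is finite, so this is a genuine maximum; it is 0 if no two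
   databases of size t differ in one entry. *)
Definition sensitivity (R : realType) (U : finType) (t : nat)
    (f : seq U -> R) : R :=
  \big[Num.max/0]_(p : t.-tuple U * t.-tuple U | differ_in_one p.1 p.2)
    `|f p.1 - f p.2|.

(* The indices (t, i) with t0 <= t <= t' and i < l t, in order of arrival.
   The i-th query at time t has 0-based index i. *)
Definition query_order (t0 t' : nat) (l : nat -> nat) : seq (nat * nat) :=
  [seq (t, i) | t <- index_iota t0 t'.+1, i <- iota 0 (l t)].

Definition num_high (R : realType) (U : finType) (T alpha : R)
    (D : nat -> seq U) (l : nat -> nat) (f : nat -> nat -> seq U -> R)
    (t : nat) : nat :=
  #|[set i : 'I_(l t) | T - alpha <= f t i (D t)]%SET|.

(* Answer of a running NATG instance with threshold noise eta to a query of
   value v at time t, with fresh noises nu and z. None stands for bot; the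
   instance halts exactly when the answer is not None. *)
Definition natg_answer (R : realType) (T : R) (xi : nat -> R) (eta : R)
    (t : nat) (v nu z : R) : option R :=
  if T + eta / xi t <= v + nu then Some (v + z) else None.

(* The transcript of NSG on the queries qs, as a function of the values of the
   noises: eta j is drawn by the j-th instance started, and nu t i, z t i are
   the noises reserved for query (t, i). run is the threshold noise of the
   running instance, if any, and n the number of instances started so far. *)
Fixpoint nsg_from (R : realType) (T : R) (xi : nat -> R)
    (v : nat -> nat -> R) (eta : nat -> R) (nu z : nat -> nat -> R)
    (run : option R) (n : nat) (qs : seq (nat * nat)) :
    seq (nat * nat * option R) :=
  if qs is (t, i) :: qs' then
    let: (e, n') := if run is Some e then (e, n) else (eta n, n.+1) in
    let a := natg_answer T xi e t (v t i) (nu t i) (z t i) in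
    (t, i, a) ::
      nsg_from T xi v eta nu z (if a is Some _ then None else Some e) n' qs'
  else [::].

Definition nsg (R : realType) (U : finType) (D : nat -> seq U) (t0 t' : nat)
    (l : nat -> nat) (f : nat -> nat -> seq U -> R) (T : R) (xi : nat -> R)
    (eta : nat -> R) (nu z : nat -> nat -> R) : seq (nat * nat * option R) :=
  nsg_from T xi (fun t i => f t i (D t)) eta nu z None 0
    (query_order t0 t' l).

Definition accurate (R : realType) (U : finType) (D : nat -> seq U)
    (f : nat -> nat -> seq U -> R) (T alpha : R)
    (tr : seq (nat * nat * option R)) : Prop :=
  forall t i a, (t, i, a) \in tr ->
    match a with
    | None => f t i (D t) <= T + alpha
    | Some r => T - alpha <= f t i (D t) /\ `|f t i (D t) - r| <= alpha
    end.

Definition laplace_pdf (R : realType) (b z : R) : R :=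
  (2 * b)^-1 * expR (- `|z| / b).

Definition has_laplace (R : realType) (d : measure_display)
    (Omega : measurableType d) (P : probability Omega R)
    (X : {RV P >-> R}) (b : R) : Prop :=
  forall A : set R, measurable A ->
    (distribution P X A
     = \int[lebesgue_measure]_(z in A) (laplace_pdf b z)%:E)%E.

Definition mutually_independent (R : realType) (d : measure_display)
    (Omega : measurableType d) (P : probability Omega R)
    (I : eqType) (J : set I) (X : I -> {RV P >-> R}) : Prop :=
  forall (s : seq I) (B : I -> set R),
    uniq s -> (forall i, i \in s -> J i) ->
    (forall i, i \in s -> measurable (B i)) ->
    (P (\bigcap_(i in [set` s]) (X i @^-1` B i))
     = \big[*%E/1%E]_(i <- s) P (X i @^-1` B i))%E.

Definition noise_index : eqType := (nat + ((nat * nat) + (nat * nat)))%type.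

Definition noise_family (A : Type) (eta : nat -> A) (nu z : nat -> nat -> A)
    (j : noise_index) : A :=
  match j with
  | inl n => eta n
  | inr (inl q) => nu q.1 q.2
  | inr (inr q) => z q.1 q.2
  end.

Definition noise_used (qs : seq (nat * nat)) : set noise_index :=
  [set j | match j with
           | inl _ => True
           | inr (inl q) => q \in qs
           | inr (inr q) => q \in qs
           end].

Definition nsg_noise (R : realType) (d : measure_display)
    (Omega : measurableType d) (P : probability Omega R)
    (xi : nat -> R) (qs : seq (nat * nat))
    (eta : nat -> {RV P >-> R}) (nu z : nat -> nat -> {RV P >-> R}) : Prop :=
  [/\ forall n, has_laplace (eta n) 2,
      forall t i, (t, i) \in qs -> has_laplace (nu t i) (4 / xi t),
      forall t i, (t, i) \in qs -> has_laplace (z t i) (8 / xi t)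
    & mutually_independent (noise_used qs) (noise_family eta nu z)].

(* Main.v *)
Require Import Defs.
From mathcomp Require Import measurable_realfun ring lra.

(* A pure union bound. Let hs list t0 followed by the times of the queries of
   value at least T - alpha, in order of arrival. Suppose that |nu_q| <= alpha/2
   for every query q, that |z_q| <= alpha for every query of value at least
   T - alpha, and that |eta_m| <= alpha xi_{hs_m} / 2 for every m < |hs|. As long
   as the answers are accurate, an instance halts only on a query of value at
   least T - alpha, so the m-th instance starts no earlier than hs_m; since xi is
   non-decreasing, its threshold noise is then at most alpha/2 at all times. This
   avoids conditioning on the random starting times of the instances, so that
   the Laplace tails of the individual noises suffice. The bound in terms of the
   budget k follows by summation by parts, as t |-> exp (- alpha xi_t / 8) is
   non-increasing. *)

Set Implicit Arguments.
Unset Strict Implicit.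
Unset Printing Implicit Defensive.

Import Order.TTheory GRing.Theory Num.Theory.
Import numFieldNormedType.Exports.
Local Open Scope classical_set_scope.
Local Open Scope ring_scope.

(** * Tails of the Laplace distribution *)

Lemma laplace_pdf_ge0 (R : realType) (b x : R) : 0 < b -> 0 <= laplace_pdf b x.
Proof.
by move=> b0; rewrite mulr_ge0 ?expR_ge0// invr_ge0 mulr_ge0 ?ltW.
Qed.

Lemma continuous_laplace_pdf (R : realType) (b : R) : continuous (laplace_pdf b).
Proof.
move=> x; apply: (@continuousM _ R^o (fun=> (2 * b)^-1)
  (fun y => expR (- `|y| / b))); first exact: cst_continuous.
apply: continuous_comp; last exact: continuous_expR.
apply: (@continuousM _ R^o (fun y => - `|y|) (fun=> b^-1)).
  by apply: (@continuousN _ R^o); exact: norm_continuous.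
exact: cst_continuous.
Qed.

(** On this half-line [x] is nonnegative, so [|x|] is [x] and the density has the antiderivative
    [F], which tends to [0] at infinity; the integral is therefore [- F a]. *)
Lemma integral_laplace_pdf_cy (R : realType) (b a : R) : 0 < b -> 0 <= a ->
  (\int[lebesgue_measure]_(x in `[a, +oo[) (laplace_pdf b x)%:E
   = (expR (- a / b) / 2)%:E)%E.
Proof.
move=> b0 a0; pose F (x : R) : R := - (expR (- (b^-1 * x)) / 2).
have dF (x : R) : is_derive x 1 F (b^-1 * expR (- (b^-1 * x)) / 2).
  apply: is_derive_eq.
  rewrite -!/(_ *: _)/= ?scaler0 ?add0r ?addr0 /GRing.scale/=.
  by ring.
have cF : continuous F.
  by move=> x; apply/differentiable_continuous/derivable1_diffP.
rewrite (@ge0_continuous_FTC2y _ _ F _ 0)//.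
- by rewrite sub0e /F -EFinN opprK mulNr [a / b]mulrC.
- by move=> x _; exact: laplace_pdf_ge0.
- by apply: continuous_subspaceT => x; exact: continuous_laplace_pdf.
(* The limit [0] is rewritten as [- (0 / 2)] to match the shape of [F]. *)
- rewrite -oppr0 -[X in - X](mul0r (2^-1)).
  apply: cvgN; apply: cvgM; last exact: cvg_cst.
  apply: (@cvg_comp _ _ _ (fun x => b^-1 * x) (fun x => expR (- x)) _ +oo%R).
    by apply: gt0_cvgMry; [rewrite invr_gt0|exact: cvg_id].
  exact: cvgr_expR.
- exact/cvg_at_right_filter/cF.
- move=> x; rewrite in_itv/= andbT => ax.
  rewrite derive1E derive_val /laplace_pdf ger0_norm; last first.
    exact: le_trans (ltW ax).
  by rewrite invfM mulNr [x / b]mulrC; ring.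
Qed.

Lemma measurable_norm_gt (R : realType) (d : measure_display)
    (Omega : measurableType d) (X : {mfun Omega >-> R}) (a : R) :
  measurable [set w | a < `|X w|].
Proof.
rewrite [X in measurable X](_ : _ = setT `&` (fun w => a < `|X w|) @^-1` [set true]).
  apply: measurable_fun_ltr => //.
  by apply: measurableT_comp.
by rewrite setTI; apply/seteqP; split.
Qed.

(** The density is even, so the two closed half-lines beyond [a] and [- a] each have mass
    [expR (- a / b) / 2], and their preimages cover the event. *)
Lemma has_laplace_tail (R : realType) (d : measure_display)
    (Omega : measurableType d) (P : probability Omega R) (X : {RV P >-> R})
    (b a : R) : has_laplace X b -> 0 < b -> 0 <= a ->
  (P [set w | (a < `|X w|)%R] <= (expR (- a / b))%:E)%E.
Proof.
move=> lapX b0 a0.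
have cL (A : set R) : {within A, continuous (laplace_pdf b)}.
  by apply: continuous_subspaceT => x; exact: continuous_laplace_pdf.
have PL A : measurable A ->
    P (X @^-1` A) = (\int[lebesgue_measure]_(z in A) (laplace_pdf b z)%:E)%E.
  by move=> mA; rewrite -lapX.
have Pr : P (X @^-1` `[a, +oo[) = (expR (- a / b) / 2)%:E.
  by rewrite PL// integral_laplace_pdf_cy.
have Pl : P (X @^-1` `]-oo, - a]) = (expR (- a / b) / 2)%:E.
  rewrite PL// ge0_integration_by_substitutionNy//; last first.
    by move=> x _; exact: laplace_pdf_ge0.
  rewrite -integral_laplace_pdf_cy//; apply: eq_integral => x _.
  by rewrite /laplace_pdf/= normrN.
have mX A : measurable A -> measurable (X @^-1` A).
  by move=> mA; rewrite -[X in measurable X]setTI; exact: measurable_funPT.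
rewrite [X in (_ <= X%:E)%E](splitr (expR _)) EFinD -{1}Pr -Pl.
apply: le_trans (measureU2 _ _ _) => //; try exact: mX.
apply: le_measure; rewrite ?inE//.
- exact: measurable_norm_gt.
- by apply: measurableU; exact: mX.
- move=> w /=; rewrite !in_itv/= andbT lerNr => /ltW; rewrite ler_normr.
  by case/orP; [left|right].
Qed.

(** * Accuracy of the transcript when all noises are small *)

Lemma accurate_cons (R : realType) (U : finType) (D : nat -> seq U)
    (f : nat -> nat -> seq U -> R) (T alpha : R) (t i : nat) (a : option R)
    (tr : seq (nat * nat * option R)) :
  accurate D f T alpha ((t, i, a) :: tr) <->
  accurate D f T alpha [:: (t, i, a)] /\ accurate D f T alpha tr.
Proof.
split=> [acc|[acc1 acc2] s j r]; last first.
  by rewrite in_cons => /orP[sj|]; [apply: acc1; rewrite inE|exact: acc2].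
split=> s j r sj; apply: acc; rewrite in_cons; last by rewrite sj orbT.
by move: sj; rewrite inE => ->.
Qed.

Lemma accurate1 (R : realType) (U : finType) (D : nat -> seq U)
    (f : nat -> nat -> seq U -> R) (T alpha : R) (t i : nat) (a : option R) :
  accurate D f T alpha [:: (t, i, a)] <->
  match a with
  | None => f t i (D t) <= T + alpha
  | Some r => T - alpha <= f t i (D t) /\ `|f t i (D t) - r| <= alpha
  end.
Proof.
split=> [acc|ok s j r]; first by apply: acc; rewrite inE.
by rewrite inE => /eqP[-> -> ->].
Qed.

Lemma path_leq_last (x s : nat) (r : seq nat) :
  path leq x r -> s \in x :: r -> (s <= last x r)%N.
Proof.
elim: r x s => [|y r IH] x s /=; first by rewrite inE => _ /eqP->.
move=> /andP[xy yr]; rewrite inE => /orP[/eqP->|]; last exact: IH.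
by apply: leq_trans xy _; apply: IH; rewrite ?mem_head.
Qed.

(** Induction on the remaining queries [qs], with [pre] those already answered. The invariant
    charges every halt to a high query of [pre]: at most [count high pre] instances have halted, and
    a running one adds one to the number started. *)
Lemma nsg_from_accurate (R : realType) (U : finType) (D : nat -> seq U)
    (f : nat -> nat -> seq U -> R) (T alpha : R) (t0 : nat) (xi : nat -> R)
    (eta : nat -> R) (nu z : nat -> nat -> R) (qs0 : seq (nat * nat)) :
  let high := fun q : nat * nat => T - alpha <= f q.1 q.2 (D q.1) in
  let hs := t0 :: [seq q.1 | q <- qs0 & high q] in
  (forall t, (t0 <= t)%N -> 0 < xi t) ->
  (forall s t, (t0 <= s)%N -> (s <= t)%N -> xi s <= xi t) ->
  path leq t0 [seq q.1 | q <- qs0] ->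
  (forall t i, (t, i) \in qs0 -> `|nu t i| <= alpha / 2) ->
  (forall t i, (t, i) \in qs0 -> high (t, i) -> `|z t i| <= alpha) ->
  (forall m, (m < size hs)%N -> `|eta m| <= alpha * xi (nth 0%N hs m) / 2) ->
  forall pre qs run n, qs0 = pre ++ qs ->
  (if run is Some e
   then exists2 m, (m <= count high pre)%N /\ e = eta m
                 & (n <= (count high pre).+1)%N
   else (n <= count high pre)%N) ->
  accurate D f T alpha
    (nsg_from T xi (fun t i => f t i (D t)) eta nu z run n qs).
Proof.
move=> high hs xi0 xile srt nuP zP etaP pre qs.
elim: qs pre => [|[t i] qs IH] pre run n qs0E inv; first by [].
rewrite /=.
set st := (if run is Some e then _ else _).
(* [m] is the index of the instance that answers this query: the running one, or instance [n] if a
   new one has to be started. *)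
have [m [mc st1] st2] : exists2 m, (m <= count high pre)%N /\ st.1 = eta m
    & (st.2 <= (count high pre).+1)%N.
  by rewrite /st; case: run inv {st} => [e [m ? ?]|?]; [exists m|exists n].
case: st st1 st2 => e n' /= {inv} -> n'c.
have tin : (t, i) \in qs0 by rewrite qs0E mem_cat mem_head orbT.
have allt : forall s, s \in t0 :: [seq q.1 | q <- pre] -> (t0 <= s <= t)%N.
  move: srt; rewrite qs0E map_cat/= cat_path/= => /and3P[p1 p2 _] s sin.
  have := order_path_min leq_trans p1 => /allP p1'.
  have t0s : (t0 <= s)%N.
    by move: sin; rewrite inE => /orP[/eqP->//|/p1'].
  rewrite t0s /=; apply: leq_trans p2.
  exact: path_leq_last.
(* Since [m <= count high pre] and [hs] starts with the extra entry [t0], entry [m] of [hs] comes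
   from [pre] or is [t0]; hence it is a time between [t0] and [t]. *)
have hsm : (nth 0%N hs m) \in t0 :: [seq q.1 | q <- pre].
  rewrite /hs qs0E filter_cat map_cat -cat_cons nth_cat/= size_map size_filter.
  rewrite ltnS mc.
  have : nth 0%N (t0 :: [seq q.1 | q <- pre & high q]) m
      \in t0 :: [seq q.1 | q <- pre & high q].
    by apply: mem_nth; rewrite /= size_map size_filter ltnS.
  rewrite !inE => /orP[->//|/mapP[q]]; rewrite mem_filter => /andP[_ qp] ->.
  by apply/orP; right; exact: map_f.
have /andP[t0m mt] := allt _ hsm.
have xit := xi0 _ (leq_trans t0m mt).
have etab : `|eta m / xi t| <= alpha / 2.
  rewrite normrM normfV (gtr0_norm xit) ler_pdivrMr//.
  have mhs : (m < size hs)%N.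
    rewrite /hs qs0E /= size_map size_filter count_cat ltnS.
    exact: leq_trans mc (leq_addr _ _).
  apply: le_trans (etaP _ mhs) _.
  rewrite mulrAC ler_wpM2l ?xile//.
  (* The remaining goal [0 <= alpha / 2] follows because [alpha / 2] bounds a norm. *)
  by have := nuP _ _ tin; apply: le_trans.
have nub := nuP _ _ tin.
move: etab nub; rewrite !ler_norml => /andP[e1 e2] /andP[u1 u2].
apply/accurate_cons; rewrite /natg_answer; case: ifPn => [le|].
  (* Passing the noisy test costs at most [alpha / 2] from [nu] and [alpha / 2] from the threshold
     noise. So the query is high, which makes the bound on [z] available and raises the count that
     pays for this halt. *)
  have hi : high (t, i) by rewrite /high/=; lra.
  split.
    apply/accurate1; split=> //.
    by rewrite opprD addrA subrr sub0r normrN zP.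
  apply: (IH (rcons pre (t, i))); first by rewrite cat_rcons.
  by rewrite -cats1 count_cat /= hi addn1.
rewrite -ltNge => lt; split; first by apply/accurate1; lra.
apply: (IH (rcons pre (t, i))); first by rewrite cat_rcons.
by exists m; [split=> //|]; rewrite -cats1 count_cat;
   [exact: leq_trans mc (leq_addr _ _)|
    apply: (leq_trans n'c); rewrite ltnS leq_addr].
Qed.

(** * Measurability of the accuracy event *)

Lemma measurable_set_ler (R : realType) (d : measure_display)
    (Omega : measurableType d) (g h : Omega -> R) :
  measurable_fun setT g -> measurable_fun setT h ->
  measurable [set w | g w <= h w].
Proof.
move=> mg mh.
rewrite [X in measurable X](_ : _ = setT `&` (fun w => g w <= h w) @^-1` [set true]).
  by apply: (measurable_fun_ler mg mh).
by rewrite setTI; apply/seteqP; split.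
Qed.

(** The running instance is given by the index of its noise rather than by its value, so that the
    state does not depend on [w]. Each query then splits the event along the measurable halting set
    [A], with a fixed next state on either side. *)
Lemma measurable_nsg_from_accurate (R : realType) (U : finType)
    (D : nat -> seq U) (f : nat -> nat -> seq U -> R) (T alpha : R)
    (xi : nat -> R) (d : measure_display) (Omega : measurableType d)
    (eta : nat -> {mfun Omega >-> R}) (nu z : nat -> nat -> {mfun Omega >-> R})
    (qs : seq (nat * nat)) (run : option nat) (n : nat) :
  measurable [set w | accurate D f T alpha
    (nsg_from T xi (fun t i => f t i (D t)) (fun m => eta m w)
       (fun t i => nu t i w) (fun t i => z t i w)
       (omap (fun m => eta m w) run) n qs)].
Proof.
elim: qs run n => [|[t i] qs IH] run n.
  rewrite [X in measurable X](_ : _ = setT)//.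
  by apply/seteqP; split.
pose st := if run is Some m then (m, n) else (n, n.+1).
pose v := f t i (D t).
pose A := [set w | T + eta st.1 w / xi t <= v + nu t i w].
pose S1 := [set w | T - alpha <= v /\ `|v - (v + z t i w)| <= alpha].
pose S2 := [set w : Omega | v <= T + alpha].
pose E r := [set w | accurate D f T alpha
    (nsg_from T xi (fun t i => f t i (D t)) (fun m => eta m w)
       (fun t i => nu t i w) (fun t i => z t i w)
       (omap (fun m => eta m w) r) st.2 qs)].
rewrite [X in measurable X](_ : _ =
   (A `&` (S1 `&` E None)) `|` (~` A `&` (S2 `&` E (Some st.1)))); last first.
  apply/seteqP; split=> w /=.
    rewrite (_ : (match omap _ run with Some e => _ | None => _ end) =
                 (eta st.1 w, st.2)); last by rewrite /st; case: (run).
    move=> /accurate_cons[/accurate1]; rewrite /natg_answer.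
    case: ifPn => [a ok acc|/negP a ok acc]; [left|right]; split=> //.
  rewrite (_ : (match omap _ run with Some e => _ | None => _ end) =
                 (eta st.1 w, st.2)); last by rewrite /st; case: (run).
  rewrite /natg_answer.
  move=> [[a [ok acc]]|[a [ok acc]]]; apply/accurate_cons.
    by rewrite ifT//; split=> //; apply/accurate1.
  by rewrite ifF; [split=> //; apply/accurate1|apply/negP].
have mA : measurable A.
  apply: measurable_set_ler.
    by apply: measurable_funD => //; apply: measurable_funM.
  by apply: measurable_funD.
have mS1 : measurable S1.
  apply: measurableI; first exact: measurable_set_ler.
  apply: measurable_set_ler => //.
  apply: measurableT_comp => //; apply: measurable_funB => //.
  by apply: measurable_funD.
have mS2 : measurable S2 by exact: measurable_set_ler.
apply: measurableU; apply: measurableI => //.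
- by apply: measurableI => //; exact: IH.
- exact: measurableC.
- by apply: measurableI => //; exact: IH.
Qed.

(** * Finite union bounds and sums over the query stream *)

Lemma measure_bigsetU_seq_le (R : realType) (d : measure_display)
    (Omega : measurableType d) (mu : {measure set Omega -> \bar R}) (I : eqType)
    (s : seq I) (B : I -> set Omega) (p : I -> R) :
  (forall i, i \in s -> measurable (B i) /\ (mu (B i) <= (p i)%:E)%E) ->
  measurable (\big[setU/set0]_(i <- s) B i) /\
  (mu (\big[setU/set0]_(i <- s) B i) <= (\sum_(i <- s) p i)%:E)%E.
Proof.
elim: s => [|i s IH] Bp; first by rewrite !big_nil measure0.
have [mB Bi] := Bp i (mem_head _ _).
have [|mS S] := IH; first by move=> j js; apply: Bp; rewrite in_cons js orbT.
rewrite !big_cons; split; first exact: measurableU.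
by rewrite EFinD (le_trans (measureU2 _ _ _))// leeD.
Qed.

Lemma sum_query_order (R : realType) (t0 t' : nat) (l : nat -> nat)
    (F : nat * nat -> R) :
  \sum_(q <- query_order t0 t' l) F q =
  \sum_(t0 <= t < t'.+1) \sum_(i < l t) F (t, i : nat).
Proof.
rewrite /query_order big_allpairs_dep; apply: eq_bigr => t _.
by rewrite -(big_mkord xpredT (fun i => F (t, i))) /index_iota subn0.
Qed.

Lemma mem_query_order (t0 t' : nat) (l : nat -> nat) (t i : nat) :
  (t, i) \in query_order t0 t' l -> (t0 <= t)%N.
Proof.
move=> /allpairsPdep[s [j [+ _ [-> _]]]].
by rewrite mem_index_iota => /andP[].
Qed.

Lemma query_order_path (t0 t' : nat) (l : nat -> nat) :
  path leq t0 [seq q.1 | q <- query_order t0 t' l].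
Proof.
rewrite /query_order /index_iota; move: (t'.+1 - t0)%N => n.
elim: n t0 => [//|n IH] t0 /=.
rewrite map_cat -map_comp cat_path.
have -> : [seq (fst \o pair t0) i | i <- iota 0 (l t0)] = nseq (l t0) t0.
  by elim: (l t0) 0%N => //= m IHm j; rewrite IHm.
have pl m : path leq t0 (nseq m t0) by elim: m => //= m ->; rewrite leqnn.
have -> : last t0 (nseq (l t0) t0) = t0 by elim: (l t0).
(* The induction hypothesis gives a path from [t0.+1]; only its first comparison has to be weakened
   to start from [t0]. *)
rewrite pl /=; move: (IH t0.+1); case: map => //= x s /andP[x0 ->].
by rewrite andbT ltnW.
Qed.

(** Summation by parts: the partial sums of [b - a] are nonnegative, so replacing a weight by a
    later, smaller one can only decrease their weighted value. *)
Lemma ler_sum_weight_noninc (R : realType) (a b c : nat -> R) (t0 n : nat) :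
  (forall t, (t0 <= t)%N -> 0 <= c t) ->
  (forall t, (t0 <= t)%N -> c t.+1 <= c t) ->
  (forall t, (t0 <= t)%N ->
     \sum_(t0 <= s < t.+1) a s <= \sum_(t0 <= s < t.+1) b s) ->
  \sum_(t0 <= s < n) a s * c s <= \sum_(t0 <= s < n) b s * c s.
Proof.
move=> c0 cd ab.
have [nt0|t0n] := leqP n t0; first by rewrite !big_geq.
rewrite -subr_ge0 -sumrB.
(* The stronger claim keeps the last weight times the whole partial sum as a nonnegative lower
   bound, which makes the induction go through; it is used with [t0 + m = n.-1]. *)
suff H m : c (t0 + m)%N * (\sum_(t0 <= s < (t0 + m).+1) (b s - a s)) <=
           \sum_(t0 <= s < (t0 + m).+1) (b s * c s - a s * c s).
  have := H (n.-1 - t0)%N; have -> : ((t0 + (n.-1 - t0)).+1 = n)%N.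
    by rewrite subnKC ?prednK//; case: n t0n.
  apply: le_trans; rewrite mulr_ge0 ?c0 ?leq_addr// sumrB subr_ge0.
  have := ab (n.-1); rewrite prednK; last by case: n t0n.
  by apply; case: n t0n.
elim: m => [|m IH].
  by rewrite addn0 !big_nat1 -mulrBl mulrC.
rewrite addnS big_nat_recr/=; last by rewrite leqW// leq_addr.
rewrite [leRHS]big_nat_recr/=; last by rewrite leqW// leq_addr.
rewrite mulrDr lerD//; last by rewrite -mulrBl mulrC.
apply: le_trans IH; rewrite ler_wpM2r ?cd ?leq_addr//.
by rewrite sumrB subr_ge0 ab// leq_addr.
Qed.

(** * Probability of an accurate transcript *)

Lemma nsg_accurate_prob (R : realType) (U : finType) (t0 t' : nat)
    (xi : nat -> R) (alpha T : R) (D : nat -> seq U) (l : nat -> nat)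
    (f : nat -> nat -> seq U -> R) (d : measure_display)
    (Omega : measurableType d) (P : probability Omega R)
    (eta : nat -> {RV P >-> R}) (nu z : nat -> nat -> {RV P >-> R}) :
  let c t := expR (- (alpha * xi t / 8)) in
  (forall t, (t0 <= t)%N -> 0 < xi t) ->
  (forall s t, (t0 <= s)%N -> (s <= t)%N -> xi s <= xi t) ->
  0 < alpha ->
  (forall n, has_laplace (eta n) 2) ->
  (forall t i, (t, i) \in query_order t0 t' l ->
     has_laplace (nu t i) (4 / xi t) /\ has_laplace (z t i) (8 / xi t)) ->
  ((1 - (c t0 + \sum_(t0 <= t < t'.+1)
      (l t + 2 * num_high T alpha D l f t)%:R * c t))%:E <=
   P [set w | accurate D f T alpha
     (nsg D t0 t' l f T xi (fun n => eta n w) (fun t i => nu t i w)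
        (fun t i => z t i w))])%E.
Proof.
move=> c xi0 xile a0 etaL nuzL.
set E := [set w | _]; set qs := query_order t0 t' l in nuzL *.
pose high (q : nat * nat) := T - alpha <= f q.1 q.2 (D q.1).
pose hs := t0 :: [seq q.1 | q <- qs & high q].
have t0qs q : q \in qs -> (t0 <= q.1)%N by case: q => t i; exact: mem_query_order.
have t0hs m : (m < size hs)%N -> (t0 <= nth 0%N hs m)%N.
  move=> /(mem_nth 0%N); rewrite inE => /orP[/eqP->//|/mapP[q]].
  by rewrite mem_filter => /andP[_ /t0qs t0q ->].
(* Scale [4 / xi t] at level [alpha / 2], and below scale [8 / xi t] at level [alpha], both give
   exactly the exponent [- (alpha * xi t / 8)]. *)
have bad_nu : forall q, q \in qs ->
    measurable [set w | alpha / 2 < `|nu q.1 q.2 w|] /\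
    (P [set w | (alpha / 2 < `|nu q.1 q.2 w|)%R] <= (c q.1)%:E)%E.
  move=> [t i] tq; split; first exact: measurable_norm_gt.
  have xt := xi0 _ (t0qs _ tq).
  have [nuL zL] := nuzL _ _ tq.
  apply: le_trans (has_laplace_tail nuL _ _) _.
  - exact: divr_gt0.
  - by rewrite divr_ge0 ?ltW.
  - rewrite lee_fin ler_expR /= -subr_le0 le_eqVlt; apply/orP; left; apply/eqP.
    by field; rewrite gt_eqF.
have bad_z : forall q, q \in [seq q <- qs | high q] ->
    measurable [set w | alpha < `|z q.1 q.2 w|] /\
    (P [set w | (alpha < `|z q.1 q.2 w|)%R] <= (c q.1)%:E)%E.
  move=> [t i]; rewrite mem_filter => /andP[_ tq].
  split; first exact: measurable_norm_gt.
  have xt := xi0 _ (t0qs _ tq).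
  have [nuL zL] := nuzL _ _ tq.
  apply: le_trans (has_laplace_tail zL _ _) _.
  - exact: divr_gt0.
  - exact: ltW.
  - rewrite lee_fin ler_expR /= -subr_le0 le_eqVlt; apply/orP; left; apply/eqP.
    by field; rewrite gt_eqF.
(* Here scale [2] gives the exponent [- (alpha * xi s / 4)] with [s] the entry [m] of [hs], which is
   even smaller than the one in [c s]. *)
have bad_eta : forall m, m \in iota 0 (size hs) ->
    measurable [set w | alpha * xi (nth 0%N hs m) / 2 < `|eta m w|] /\
    (P [set w | (alpha * xi (nth 0%N hs m) / 2 < `|eta m w|)%R] <=
     (c (nth 0%N hs m))%:E)%E.
  move=> m; rewrite mem_iota add0n => /t0hs/xi0 xm.
  have axm : 0 < alpha * xi (nth 0%N hs m) by exact: mulr_gt0.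
  split; first exact: measurable_norm_gt.
  apply: le_trans (has_laplace_tail (etaL m) _ _) _ => //.
  - by rewrite divr_ge0 ?ltW.
  - by rewrite lee_fin ler_expR; lra.
have [mN PN] := measure_bigsetU_seq_le bad_nu.
have [mZ PZ] := measure_bigsetU_seq_le bad_z.
have [mH PH] := measure_bigsetU_seq_le bad_eta.
set BN := \big[setU/set0]_(q <- qs) _ in mN PN.
set BZ := \big[setU/set0]_(q <- [seq q <- qs | high q]) _ in mZ PZ.
set BH := \big[setU/set0]_(m <- iota 0 (size hs)) _ in mH PH.
have mE : measurable E.
  exact: (measurable_nsg_from_accurate D f T alpha xi eta nu z qs None 0%N).
have EB : ~` E `<=` BN `|` BZ `|` BH.
  move=> w; apply: contra_notP => nB.
  have nBU (I : choiceType) (s : seq I) (B : I -> set Omega) i :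
      i \in s -> ~ (\big[setU/set0]_(i <- s) B i) w -> ~ B i w.
    by move=> si; rewrite -bigcup_seq => + Bi; apply; exists i.
  have /not_orP[/not_orP[nN nZ] nH] := nB.
  apply: (@nsg_from_accurate R U D f T alpha t0 xi _ _ _ qs
            _ _ _ _ _ _ [::]) => //.
  - exact: query_order_path.
  - by move=> t i tq; rewrite leNgt; apply/negP; exact: (nBU _ _ _ (t, i) tq nN).
  - move=> t i tq hi; rewrite leNgt; apply/negP.
    by apply: (nBU _ _ _ (t, i) _ nZ); rewrite mem_filter tq andbT.
  - move=> m mhs; rewrite leNgt; apply/negP.
    by apply: (nBU _ _ _ m _ nH); rewrite mem_iota.
(* At each time [t] the noises [nu] contribute [l t] terms and the noises [z] one per high query.
   The [eta] contribute one more per high query, and [c t0] for the first entry of [hs]. *)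
have sumE : \sum_(q <- qs) c q.1 + \sum_(q <- [seq q <- qs | high q]) c q.1 +
    \sum_(m <- iota 0 (size hs)) c (nth 0%N hs m) =
  c t0 + \sum_(t0 <= t < t'.+1) (l t + 2 * num_high T alpha D l f t)%:R * c t.
  have -> : \sum_(m <- iota 0 (size hs)) c (nth 0%N hs m) =
            c t0 + \sum_(q <- [seq q <- qs | high q]) c q.1.
    rewrite -[iota _ _]/(index_iota 0 (size hs)) -(big_nth 0%N xpredT c).
    by rewrite big_cons big_map.
  rewrite addrCA -addrA; congr (_ + _).
  rewrite big_filter (big_mkcond high) !sum_query_order -!big_split/=.
  apply: eq_bigr => t _.
  rewrite -big_mkcond/= sumr_const card_ord sumr_const.
  rewrite (_ : #|_| = num_high T alpha D l f t); last first.
    by rewrite /num_high cardsE.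
  by rewrite natrD natrM !mulr_natl mulrDl; ring.
rewrite -sumE -[E]setCK probability_setC; last exact: measurableC.
rewrite EFinB leeB//.
rewrite !EFinD; apply: le_trans (leeD (leeD PN PZ) PH).
apply: (@le_trans _ _ (P (BN `|` BZ `|` BH))).
  apply: le_measure; rewrite ?inE//; first exact: measurableC.
  by apply: measurableU => //; exact: measurableU.
apply: le_trans (measureU2 _ _ _) _ => //; first exact: measurableU.
by rewrite leeD2r// measureU2.
Qed.

Theorem theorem38 (R : realType) (U : finType) (t0 t' : nat)
  (xi Delta k : nat -> R) (alpha T beta : R)
  (D : nat -> seq U) (l : nat -> nat) (f : nat -> nat -> seq U -> R)
  (d : measure_display) (Omega : measurableType d) (P : probability Omega R)
  (eta : nat -> {RV P >-> R}) (nu z : nat -> nat -> {RV P >-> R})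
  (xi_gt0 : forall t, (t0 <= t)%N -> 0 < xi t)
  (Delta_gt0 : forall t, (t0 <= t)%N -> 0 < Delta t)
  (Delta_noninc : forall s t, (t0 <= s)%N -> (s <= t)%N -> Delta t <= Delta s)
  (xiDelta_noninc : forall s t, (t0 <= s)%N -> (s <= t)%N ->
     xi t * Delta t <= xi s * Delta s)
  (xi_nondec : forall s t, (t0 <= s)%N -> (s <= t)%N -> xi s <= xi t)
  (alpha_gt0 : 0 < alpha)
  (D_stream : database_stream t0 D)
  (l_finite : forall t, (t' < t)%N -> l t = 0%N)
  (f_sensitivity : forall t i, (t0 <= t <= t')%N -> (i < l t)%N ->
     sensitivity t (f t i) <= Delta t)
  (budget : forall t, (t0 <= t)%N ->
     (\sum_(t0 <= s < t.+1) l s)%:R <= \sum_(t0 <= s < t.+1) k s)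
  (noise : nsg_noise xi (query_order t0 t' l) eta nu z) :
  let E := [set w : Omega | accurate D f T alpha
    (nsg D t0 t' l f T xi (fun n => eta n w) (fun t i => nu t i w)
       (fun t i => z t i w))] in
  let c t := expR (- (alpha * xi t / 8)) in
  let h := num_high T alpha D l f in
  (((c t0)%:E + \sum_(t0 <= t <oo) ((l t + 2 * h t)%:R * c t)%:E
      <= beta%:E)%E ->
   ((1 - beta)%:E <= P E)%E) /\
  (cvg ((fun n => \sum_(t0 <= t < n) (k t * c t)%:E)%E @ \oo) ->
   ((c t0)%:E + 3%:E * \sum_(t0 <= t <oo) (k t * c t)%:E <= beta%:E)%E ->
   ((1 - beta)%:E <= P E)%E).
Proof.
move=> E c h.
have [etaL nuL zL _] := noise.
have main := nsg_accurate_prob T D f xi_gt0 xi_nondec alpha_gt0 etaL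
  (fun t i tq => conj (nuL t i tq) (zL t i tq)).
rewrite -/c -/E -/h in main.
have c0 t : 0 <= c t by exact: expR_ge0.
split=> [betaP|cvgk betaP]; apply: le_trans main; rewrite lee_fin lerB//.
  rewrite -lee_fin; apply: le_trans betaP; rewrite EFinD leeD2l// -sumEFin.
  by apply: nneseries_lim_ge => t _ _; rewrite lee_fin mulr_ge0.
rewrite -lee_fin; apply: le_trans betaP; rewrite EFinD leeD2l//.
(* The factor [3] arises from [h t <= l t]. *)
have hl t : (l t + 2 * h t <= 3 * l t)%N.
  have : (h t <= l t)%N by rewrite /h /num_high -[leqRHS]card_ord max_card.
  by move=> ?; rewrite (mulnDl 1 2) mul1n leq_add2l leq_mul2l.
apply: (@le_trans _ _ (3%:E * (\sum_(t0 <= t < t'.+1) (l t)%:R * c t)%:E)%E).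
  rewrite -EFinM lee_fin mulr_sumr ler_sum// => t _.
  by rewrite mulrA ler_wpM2r// -natrM ler_nat.
rewrite lee_pmul2l//.
(* The terms [k t * c t] may be negative, so partial sums need not lie below the limit. Instead the
   finite query sum is bounded by every partial sum with [n] large enough, and [cvgk] allows passing
   to the limit. *)
apply: lime_ge => //; near=> n.
rewrite sumEFin lee_fin.
apply: (@le_trans _ _ (\sum_(t0 <= t < n) (l t)%:R * c t)).
  (* If [t' < t0] the query sum is empty; otherwise extending it from [t'.+1] to [n] adds
     nonnegative terms. *)
  have [t't0|t0t'] := leqP t'.+1 t0.
    by rewrite big_geq// sumr_ge0// => t _; rewrite mulr_ge0.
  rewrite [leRHS](big_cat_nat (ltnW t0t'))/=; last by near: n; exact: nbhs_infty_ge.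
  by rewrite lerDl sumr_ge0// => t _; rewrite mulr_ge0.
apply: ler_sum_weight_noninc => // t t0t.
- rewrite ler_expR lerN2 ler_pM2r ?invr_gt0// ler_pM2l// xi_nondec//.
- by rewrite -natr_sum budget.
Unshelve. all: by end_near. Qed.
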